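(* Let $r$ be such that $1\le r<m$, and let $A_i$ and $B_i$ be the functions defined in the context. Then, for fixed $\sigma_i$ and $\epsilon$, the following hold. (1) For $i=1,\dots,r$, if $0<\epsilon<0.325\,\sigma_i^2$, then $$\beta_i^A=\frac{\sqrt{\sigma_i^6-2\epsilon\sigma_i^4-3\epsilon^2\sigma_i^2-\epsilon^3}}{\epsilon+2\sigma_i^2}>0$$ and $$A_i(\gamma_i,\sigma_i,\epsilon)>0\iff\gamma_i\in\left(\gamma_i^{A_i^{\max}}-\beta_i^A,\ \gamma_i^{A_i^{\max}}+\beta_i^A\right),\qquad\text{where }\ \gamma_i^{A_i^{\max}}=\frac{\sigma_i(\sigma_i^2+\epsilon)}{2\sigma_i^2+\epsilon}.$$ (2) For $i=r+1,\dots,m$, $$B_i(\gamma_i,\sigma_i,\epsilon)>0\iff\gamma_i\in\left(0,\ x_i^{-1}-\beta_i^B\right)\cup\left(x_i^{-1}+\beta_i^B,\ \infty\right),$$ where $x_i^{-1}=\sigma_i+\frac{\epsilon}{\sigma_i}$ and $\beta_i^B=\sqrt{\sigma_i^2+\frac{\epsilon^2}{\sigma_i^2}+\epsilon}$.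
   Context: Here $m$ and $r$ are integers, and $\gamma_i>0$, $\sigma_i>0$ ($i=1,\dots,m$) and $\epsilon>0$ are real numbers. In the application, $\gamma_i$ and $\sigma_i$ are the singular values of a real $n\times m$ matrix of rank $m$ and of its perturbation, also of rank $m$, and $\epsilon$ is the noise power. Put $x_i=\frac{\sigma_i}{\sigma_i^2+\epsilon}$ and define, for $i=1,\dots,m$, $$A_i(\gamma_i,\sigma_i,\epsilon)=\left[x_i^2(\gamma_i^2+\epsilon)-2x_i\gamma_i\right]-\left[\frac{\epsilon}{\sigma_i^2}+\left(\frac{\gamma_i}{\sigma_i}-1\right)^2\right]+1,$$ $$B_i(\gamma_i,\sigma_i,\epsilon)=x_i^2(\gamma_i^2+\epsilon)-2x_i\gamma_i .$$
   Formalization: In (1) the constant 0.325 is replaced by the root t = 0.32471... of 1 - 2t - 3t^2 - t^3, of which 0.325 is a rounding; for ε/σ_i^2 in [t, 0.325) the radicand of β_i^A is not positive (σ_i = 1, ε = 0.3249), so β_i^A > 0 fails. *)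

(* Defs.v *)
From Stdlib Require Import Reals.
Local Open Scope R_scope.

Definition xcoef (sigma eps : R) : R := sigma / (sigma ^ 2 + eps).

Definition Bfun (gamma sigma eps : R) : R :=
  (xcoef sigma eps) ^ 2 * (gamma ^ 2 + eps) - 2 * xcoef sigma eps * gamma.

Definition Afun (gamma sigma eps : R) : R :=
  ((xcoef sigma eps) ^ 2 * (gamma ^ 2 + eps) - 2 * xcoef sigma eps * gamma)
  - (eps / sigma ^ 2 + (gamma / sigma - 1) ^ 2) + 1.

Definition betaA_radicand (sigma eps : R) : R :=
  sigma ^ 6 - 2 * eps * sigma ^ 4 - 3 * eps ^ 2 * sigma ^ 2 - eps ^ 3.

(* [sqrt] is 0 on negative reals; the radicand is positive exactly when
   eps / sigma ^ 2 lies below the threshold introduced next. *)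
Definition betaA (sigma eps : R) : R :=
  sqrt (betaA_radicand sigma eps) / (eps + 2 * sigma ^ 2).

Definition gammaAmax (sigma eps : R) : R :=
  sigma * (sigma ^ 2 + eps) / (2 * sigma ^ 2 + eps).

Definition betaB (sigma eps : R) : R :=
  sqrt (sigma ^ 2 + eps ^ 2 / sigma ^ 2 + eps).

(* The bound on eps / sigma ^ 2 usually quoted as 0.325 is, to three decimals,
   the positive root t = 0.32471... of 1 - 2 t - 3 t ^ 2 - t ^ 3, which is
   [betaA_radicand] divided by sigma ^ 6 at eps = t * sigma ^ 2.  Taking 0.325
   exactly would make the radicand negative for eps / sigma ^ 2 between the
   root and 0.325 (sigma = 1 and eps = 0.3249, say). *)
Definition eps_threshold (t : R) : Prop :=
  0.3245 <= t < 0.3255 /\ betaA_radicand 1 t = 0.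

(* Main.v *)
(** Both functions are quadratic in [gamma], so completing the square settles
    their signs.  With [x = xcoef sigma eps], [B / x ^ 2] is
    [(gamma - 1 / x) ^ 2 - betaB ^ 2], and [A] is a positive multiple of
    [betaA ^ 2 - (gamma - gammaAmax) ^ 2].  The radicand of [betaA] is
    homogeneous in [(sigma ^ 2, eps)] and decreasing in [eps], so it is positive
    as long as [eps / sigma ^ 2] stays below its root. *)
Require Import Defs.
From Stdlib Require Import Reals Lra Lia.
Local Open Scope R_scope.

(** This and the next lemma turn a completed square into intervals; [nra] compares [u ^ 2] with
    [sqrt d * sqrt d]. *)
Lemma Rsqr_lt_sqrt_iff (u d : R) : 0 <= d ->
  (u ^ 2 < d <-> - sqrt d < u < sqrt d).
Proof.
intros Hd.
pose proof (sqrt_pos d) as Hs; pose proof (sqrt_sqrt d Hd) as Hss.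
split; [intros H; split|intros [H1 H2]]; nra.
Qed.

Lemma sqrt_lt_Rsqr_iff (u d : R) : 0 <= d ->
  (d < u ^ 2 <-> u < - sqrt d \/ sqrt d < u).
Proof.
intros Hd.
pose proof (sqrt_pos d) as Hs; pose proof (sqrt_sqrt d Hd) as Hss.
split; [intros H|intros [H|H]; nra].
destruct (Rlt_dec (sqrt d) u) as [|Hu]; [now right|left].
destruct (Rlt_dec u (- sqrt d)) as [|Hu']; [easy|nra].
Qed.

Lemma Rmult_pos_iff (k y : R) : 0 < k -> (0 < k * y <-> 0 < y).
Proof. intros Hk; split; intros H; nra. Qed.

Lemma eps_threshold_exists : exists t : R, eps_threshold t.
Proof.
(* The sign is flipped because [IVT] wants a negative value at the left end and a positive one at
   the right. *)
assert (Hc : continuity (fun t => - betaA_radicand 1 t)).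
{ unfold betaA_radicand; apply derivable_continuous; reg. }
destruct (IVT _ 0.3245 0.3255 Hc) as [t [Ht H0]];
  [lra|unfold betaA_radicand; lra|unfold betaA_radicand; lra|].
exists t; unfold eps_threshold; repeat split; try lra.
(* [IVT] locates the root in a closed interval; the right end is excluded since the polynomial is
   nonzero there. *)
destruct (Rle_lt_or_eq_dec t 0.3255 (proj2 Ht)) as [|E]; [easy|].
subst t; unfold betaA_radicand in H0; lra.
Qed.

Lemma betaA_radicand_scale (sigma u : R) :
  betaA_radicand sigma (u * sigma ^ 2) = sigma ^ 6 * betaA_radicand 1 u.
Proof. unfold betaA_radicand; ring. Qed.

Lemma betaA_radicand_decreasing (u t : R) : 0 < u < t ->
  betaA_radicand 1 t < betaA_radicand 1 u.
Proof.
intros [Hu Hut]; unfold betaA_radicand.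
assert (u ^ 2 < t ^ 2) by nra.
assert (u ^ 3 < t ^ 3) by nra.
lra.
Qed.

Lemma betaA_radicand_pos (t sigma eps : R) : betaA_radicand 1 t = 0 ->
  0 < sigma -> 0 < eps < t * sigma ^ 2 -> 0 < betaA_radicand sigma eps.
Proof.
intros Ht Hs [He Het].
assert (Hs2 : 0 < sigma ^ 2) by (apply pow_lt; lra).
assert (E : eps = eps / sigma ^ 2 * sigma ^ 2) by (field; lra).
rewrite E, betaA_radicand_scale.
apply Rmult_lt_0_compat; [apply pow_lt; lra|].
rewrite <- Ht; apply betaA_radicand_decreasing; split.
- apply Rdiv_lt_0_compat; lra.
- apply Rmult_lt_reg_r with (sigma ^ 2); lra.
Qed.

Lemma inv_xcoef (sigma eps : R) : 0 < sigma -> 0 < eps ->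
  / xcoef sigma eps = sigma + eps / sigma.
Proof. intros Hs He; unfold xcoef; field; split; nra. Qed.

(** The coefficient of [gamma ^ 2] in [Afun] is [x ^ 2 - 1 / sigma ^ 2] with [x = xcoef sigma eps].
    It is negative and equals minus the prefactor here, so the parabola opens downwards, with vertex
    at [gammaAmax]. *)
Lemma Afun_square (gamma sigma eps : R) : 0 < sigma -> 0 < eps ->
  Afun gamma sigma eps =
  eps * (2 * sigma ^ 2 + eps) / (sigma * (sigma ^ 2 + eps)) ^ 2 *
  (betaA_radicand sigma eps / (eps + 2 * sigma ^ 2) ^ 2
   - (gamma - gammaAmax sigma eps) ^ 2).
Proof.
intros Hs He; unfold Afun, gammaAmax, xcoef, betaA_radicand.
field; repeat split; nra.
Qed.

(** The subtracted constant is [1 / x ^ 2 - eps], expanded using [1 / x = sigma + eps / sigma]. *)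
Lemma Bfun_square (gamma sigma eps : R) : 0 < sigma -> 0 < eps ->
  Bfun gamma sigma eps =
  xcoef sigma eps ^ 2 *
  ((gamma - / xcoef sigma eps) ^ 2 - (sigma ^ 2 + eps ^ 2 / sigma ^ 2 + eps)).
Proof.
intros Hs He; rewrite (inv_xcoef _ _ Hs He); unfold Bfun, xcoef.
field; repeat split; nra.
Qed.

(** Moving the denominator under the root gives the constant of [Afun_square], so that
    [Rsqr_lt_sqrt_iff] applies. *)
Lemma betaA_sqrt (sigma eps : R) : 0 < eps -> 0 < betaA_radicand sigma eps ->
  betaA sigma eps = sqrt (betaA_radicand sigma eps / (eps + 2 * sigma ^ 2) ^ 2).
Proof.
intros He Hr; pose proof (pow2_ge_0 sigma) as Hs.
unfold betaA; rewrite sqrt_div_alt, sqrt_pow2; [easy|lra|apply pow_lt; lra].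
Qed.

Lemma Afun_pos_iff (gamma sigma eps : R) : 0 < sigma -> 0 < eps ->
  0 < betaA_radicand sigma eps ->
  (0 < Afun gamma sigma eps <->
   gammaAmax sigma eps - betaA sigma eps < gamma
     < gammaAmax sigma eps + betaA sigma eps).
Proof.
intros Hs He Hr; assert (Hs2 : 0 < sigma ^ 2) by (apply pow_lt; lra).
rewrite Afun_square, Rmult_pos_iff, betaA_sqrt by
  (try apply Rdiv_lt_0_compat; try apply pow_lt; nra).
set (d := betaA_radicand sigma eps / _).
assert (Hd : 0 <= d).
{ apply Rlt_le, Rdiv_lt_0_compat; [easy|apply pow_lt; lra]. }
pose proof (Rsqr_lt_sqrt_iff (gamma - gammaAmax sigma eps) d Hd) as [H1 H2].
split; intros H.
- assert (H' := H1 ltac:(lra)); lra.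
- assert (H' := H2 ltac:(lra)); lra.
Qed.

Lemma Bfun_pos_iff (gamma sigma eps : R) : 0 < sigma -> 0 < eps ->
  (0 < Bfun gamma sigma eps <->
   gamma < / xcoef sigma eps - betaB sigma eps \/
   / xcoef sigma eps + betaB sigma eps < gamma).
Proof.
intros Hs He; assert (Hs2 : 0 < sigma ^ 2) by (apply pow_lt; lra).
rewrite Bfun_square, Rmult_pos_iff by
  (try apply pow_lt; try apply Rdiv_lt_0_compat; lra).
unfold betaB; set (d := sigma ^ 2 + _ + _).
assert (Hd : 0 <= d).
{ assert (0 < eps ^ 2 / sigma ^ 2)
    by (apply Rdiv_lt_0_compat; [apply pow_lt|]; lra).
  unfold d; lra. }
pose proof (sqrt_lt_Rsqr_iff (gamma - / xcoef sigma eps) d Hd) as [H1 H2].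
split; intros H.
- destruct (H1 ltac:(lra)); [left|right]; lra.
- assert (H' := H2 ltac:(destruct H; [left|right]; lra)); lra.
Qed.

(** By [betaA_radicand_decreasing] only one [t] satisfies [eps_threshold], so the existential pins
    down a single constant, chosen before all other data. *)
Theorem proposition4 :
  exists t : R, eps_threshold t /\
  forall (m r : nat) (gamma sigma : nat -> R) (eps : R),
  (1 <= r < m)%nat ->
  (forall i : nat, (1 <= i <= m)%nat -> 0 < gamma i) ->
  (forall i : nat, (1 <= i <= m)%nat -> 0 < sigma i) ->
  0 < eps ->
  (forall i : nat, (1 <= i <= r)%nat ->
     0 < eps < t * sigma i ^ 2 ->
     0 < betaA (sigma i) eps /\
     (0 < Afun (gamma i) (sigma i) eps <->
      gammaAmax (sigma i) eps - betaA (sigma i) eps < gamma i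
        < gammaAmax (sigma i) eps + betaA (sigma i) eps)) /\
  (forall i : nat, (r + 1 <= i <= m)%nat ->
     / xcoef (sigma i) eps = sigma i + eps / sigma i /\
     (0 < Bfun (gamma i) (sigma i) eps <->
      0 < gamma i < / xcoef (sigma i) eps - betaB (sigma i) eps \/
      / xcoef (sigma i) eps + betaB (sigma i) eps < gamma i)).
Proof.
destruct eps_threshold_exists as [t Ht]; exists t; split; [exact Ht|].
intros m r gamma sigma eps Hrm Hg Hs He; split; intros i Hi.
- intros Het; assert (Hsi : 0 < sigma i) by (apply Hs; lia).
  assert (Hr := betaA_radicand_pos _ _ _ (proj2 Ht) Hsi Het).
  split; [|now apply Afun_pos_iff].
  apply Rdiv_lt_0_compat; [now apply sqrt_lt_R0|nra].
- assert (Hsi : 0 < sigma i) by (apply Hs; lia).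
  assert (Hgi : 0 < gamma i) by (apply Hg; lia).
  split; [now apply inv_xcoef|].
  (* [Bfun_pos_iff] puts no lower bound on [gamma] in the left interval; [Hgi] supplies the bound
     0. *)
  rewrite Bfun_pos_iff by assumption; tauto.
Qed.
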